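(* Let $0\le r<1$, $t>0$, and let $\Sigma=(\Sigma_{ij})$ be a $d\times d$ covariance matrix in the class $\mathcal U(r,s_0,M)$. Then for any symmetric $d\times d$ matrix $\Gamma=(\Gamma_{ij})$ and any soft-thresholding operator $\mathcal S_t$, $$\|\mathcal S_t\Gamma-\Sigma\|_{op}\le 2t^{1-r}s_0+\|\Gamma-\Sigma\|_\infty\Big(\#\big(|\Gamma_{ij}-\Sigma_{ij}|>(1-\gamma)t\big)+\frac{1}{(\gamma t)^r}s_0+\frac{2}{t^r}s_0\Big)$$ for any $0<\gamma<1$.
   Context: $\|\cdot\|_{op}$ is the spectral norm, $\|\cdot\|_\infty$ the entrywise maximum norm. $\#(|\Gamma_{ij}-\Sigma_{ij}|>c)$ denotes the number of index pairs $(i,j)$, $1\le i,j\le d$, with $|\Gamma_{ij}-\Sigma_{ij}|>c$. The class is $$\mathcal U(r,s_0,M)=\Big\{\Sigma:\ \Sigma_{ii}\le M,\ \sum_{j=1}^d|\Sigma_{ij}|^r\le s_0,\ 1\le i\le d\Big\}$$ for constants $M$ and $s_0=s_0(d)$. A soft-thresholding operator with threshold $t$ is a map $\mathcal S_t:\mathbb R^{d\times d}\to\mathbb R^{d\times d}$ acting entrywise, $\mathcal S_t\Gamma=(\mathcal S_t(\Gamma_{ij}))_{ij}$, such that for all $x\in\mathbb R$: (1) $|\mathcal S_t(x)|\le|x|$; (2) $\mathcal S_t(x)=0$ for $|x|\le t$; (3) $|\mathcal S_t(x)-x|\le t$. *)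

(* Defs.v *)
From HB Require Import structures.
From mathcomp Require Import all_boot all_order all_algebra.
From mathcomp Require Import all_classical all_reals all_analysis.

Set Implicit Arguments.
Unset Strict Implicit.
Unset Printing Implicit Defensive.

Import Order.TTheory GRing.Theory Num.Theory.
Import numFieldNormedType.Exports.

Local Open Scope classical_set_scope.
Local Open Scope ring_scope.

Definition l2norm (R : realType) (d : nat) (x : 'cV[R]_d) : R :=
  Num.sqrt (\sum_(i < d) x i 0 ^+ 2).

(* Spectral norm: the operator norm induced by the Euclidean norm.  The set is
   nonempty and bounded (has_sup_op_norm), so [sup] is a genuine supremum. *)
Definition op_norm (R : realType) (d : nat) (A : 'M[R]_d) : R :=
  sup [set l2norm (A *m x) | x in [set x : 'cV[R]_d | l2norm x <= 1]].

Lemma has_sup_op_norm (R : realType) (d : nat) (A : 'M[R]_d) :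
  has_sup [set l2norm (A *m x) | x in [set x : 'cV[R]_d | l2norm x <= 1]].
Proof.
split.
  exists (l2norm (A *m 0)), 0 => //=; rewrite /l2norm big1 ?sqrtr0 ?ler01 //.
  by move=> i _; rewrite mxE expr0n.
exists (Num.sqrt (\sum_i (\sum_j `|A i j|) ^+ 2)) => _ [x x1 <-].
have x1j j : `|x j 0| <= 1.
  apply: le_trans x1; rewrite -sqrtr_sqr ler_wsqrtr // (bigD1 j) //=.
  by rewrite lerDl sumr_ge0 // => i _; exact: sqr_ge0.
rewrite ler_wsqrtr // ler_sum // => i _.
rewrite mxE -[leLHS]real_normK ?num_real // lerXn2r ?nnegrE ?sumr_ge0 //.
apply: le_trans (ler_norm_sum _ _ _) _; apply: ler_sum => j _.
by rewrite normrM ler_piMr.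
Qed.

Definition covariance_matrix (R : realType) (d : nat) (Sigma : 'M[R]_d) : Prop :=
  exists (disp : measure_display) (T : measurableType disp)
    (P : probability T R) (X : 'I_d -> {RV P >-> R}),
    (forall i, (X i : T -> R) \in Lfun P 2%:E) /\
    (forall i j, covariance P (X i) (X j) = (Sigma i j)%:E).

(* |x|^r with the convention 0^0 = 0, under which r = 0 counts the nonzero
   entries of a row; the library has 0 `^ 0 = 1, and the two agree otherwise. *)
Definition abs_pow (R : realType) (r x : R) : R :=
  if x == 0 then 0 else `|x| `^ r.

Definition sparse_class (R : realType) (d : nat) (r s0 M : R) : set 'M[R]_d :=
  [set Sigma : 'M[R]_d | forall i : 'I_d,
     Sigma i i <= M /\ \sum_(j < d) abs_pow r (Sigma i j) <= s0].

Definition soft_thresholding (R : realType) (t : R) (S : R -> R) : Prop :=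
  forall x : R,
    [/\ `|S x| <= `|x|, `|x| <= t -> S x = 0 & `|S x - x| <= t].

Definition count_exceed (R : realType) (d : nat) (Gamma Sigma : 'M[R]_d) (c : R) : nat :=
  #|[pred p : 'I_d * 'I_d | c < `|Gamma p.1 p.2 - Sigma p.1 p.2|]|.

(* Main.v *)
Require Import Defs.
From HB Require Import structures.
From mathcomp Require Import all_boot all_order all_algebra.
From mathcomp Require Import all_classical all_reals all_analysis.
From mathcomp Require Import ring lra.

Import Order.TTheory GRing.Theory Num.Theory.
Import numFieldNormedType.Exports.

Local Open Scope ring_scope.

(** The spectral norm of a symmetric matrix is at most its largest absolute
row sum ([op_norm_le_row_sum], from the Schur test [l2norm_mulmx_le]), so it
is enough to bound the row sums of [S Gamma - Sigma]; the two matrices are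
symmetric, [Sigma] because it is a covariance matrix.

Rows are bounded entry by entry ([soft_threshold_entry]).  Write [a] and [b]
for an entry of [Gamma] and of [Sigma].
- If [b] exceeds [t] in absolute value, then [|S a - b| <= t + |a - b|].
- If [|a|] and [|b|] are at most [t], then [S a = 0] and the error is [|b|].
- If [|b| <= t < |a|], then the error is at most [|a - b| + 2 |b|].  Here
  either [|a - b| > (1 - gamma) t], which is one of the counted events, or
  [|b| >= gamma t].
Sparsity enters through two elementary facts on [|b|^r]: it dominates
[c^r] on the event [|b| >= c], as in Markov's inequality
([abs_pow_markov]), and [|b| <= t^(1-r) |b|^r] when [|b| <= t]
([norm_le_abs_pow]).  Every term is then a multiple of [|b|^r], whose row
sum is at most [s0], or is the norm of [Gamma - Sigma] times the indicator of
a counted event. *)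

(** * Spectral norm and row sums *)

(** Schur's test: expand each squared coordinate of [A x] into a double sum,
use [2 x_j x_k <= x_j^2 + x_k^2], and then sum out the weights [|A i k|]
along rows and [|A i j|] along columns, each time paying a factor [C]. *)
Lemma l2norm_mulmx_le (R : realType) (d : nat) (A : 'M[R]_d) (C : R)
    (x : 'cV[R]_d) :
  0 <= C ->
  (forall i, \sum_j `|A i j| <= C) -> (forall j, \sum_i `|A i j| <= C) ->
  l2norm (A *m x) <= C * l2norm x.
Proof.
move=> C0 rowC colC; rewrite /l2norm.
rewrite -[X in X * _](ger0_norm C0) -sqrtr_sqr -sqrtrM ?sqr_ge0//.
apply: ler_wsqrtr.
have row_bound i : (A *m x) i 0 ^+ 2 <= C * \sum_j `|A i j| * x j 0 ^+ 2.
  have -> : (A *m x) i 0 ^+ 2 =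
      \sum_j \sum_k (A i j * x j 0) * (A i k * x k 0).
    by rewrite mxE expr2 big_distrlr.
  (* the bound on products is symmetrized in [j] and [k] before it is summed *)
  pose T j k := `|A i j| * `|A i k| * x j 0 ^+ 2.
  have prodT j k : (A i j * x j 0) * (A i k * x k 0) <= 2^-1 * (T j k + T k j).
    apply: le_trans (ler_norm _) _; rewrite !normrM /T.
    rewrite -(real_normK (num_real (x j 0))) -(real_normK (num_real (x k 0))).
    rewrite -subr_ge0.
    suff -> : 2^-1 * (`|A i j| * `|A i k| * `|x j 0| ^+ 2 +
        `|A i k| * `|A i j| * `|x k 0| ^+ 2) -
        `|A i j| * `|x j 0| * (`|A i k| * `|x k 0|) =
        2^-1 * (`|A i j| * `|A i k|) * (`|x j 0| - `|x k 0|) ^+ 2.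
      by rewrite mulr_ge0 ?sqr_ge0// mulr_ge0 ?mulr_ge0 ?invr_ge0.
    by field.
  apply: (@le_trans _ _ (\sum_j \sum_k T j k)).
    have -> : \sum_j \sum_k T j k = \sum_j \sum_k 2^-1 * (T j k + T k j).
      under [RHS]eq_bigr do rewrite -mulr_sumr big_split.
      rewrite -mulr_sumr big_split /= [X in _ + X]exchange_big /=.
      by field.
    by apply: ler_sum => j _; apply: ler_sum => k _; exact: prodT.
  rewrite mulr_sumr; apply: ler_sum => j _.
  rewrite /T -mulr_suml -mulr_sumr mulrAC mulrC.
  by rewrite ler_wpM2r// mulr_ge0// sqr_ge0.
apply: (@le_trans _ _ (\sum_i C * \sum_j `|A i j| * x j 0 ^+ 2)).
  by apply: ler_sum => i _; exact: row_bound.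
rewrite -mulr_sumr expr2 -mulrA ler_wpM2l// exchange_big mulr_sumr /=.
apply: ler_sum => j _; rewrite -mulr_suml.
by rewrite ler_wpM2r// sqr_ge0.
Qed.

Lemma op_norm_le_row_sum (R : realType) (d : nat) (A : 'M[R]_d) (C : R) :
  0 <= C -> A^T = A -> (forall i, \sum_j `|A i j| <= C) -> op_norm A <= C.
Proof.
move=> C0 Asym rowC; apply: ge_sup; first exact: (has_sup_op_norm A).1.
move=> _ [x /= x1 <-].
apply: (@le_trans _ _ (C * l2norm x)); last by rewrite ler_piMr.
apply: l2norm_mulmx_le => // j; apply: le_trans (rowC j).
by apply: ler_sum => i _; rewrite -{1}Asym mxE.
Qed.

Lemma norm_entry_le_mx_norm (R : realType) (m n : nat) (A : 'M[R]_(m, n)) i j :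
  `|A i j| <= mx_norm A.
Proof. by rewrite mx_normrE; apply/bigmax_geP; right => /=; exists (i, j). Qed.

Lemma covariance_matrix_sym (R : realType) (d : nat) (Sigma : 'M[R]_d) :
  covariance_matrix Sigma -> Sigma^T = Sigma.
Proof.
move=> [disp [T [P [X [_ covX]]]]]; apply/matrixP => i j; rewrite mxE.
by apply: EFin_inj; rewrite -!covX covarianceC.
Qed.

(** * Entrywise error *)

Lemma abs_pow_ge0 (R : realType) (r x : R) : 0 <= abs_pow r x.
Proof. by rewrite /abs_pow; case: ifP => // _; exact: powR_ge0. Qed.

Lemma abs_pow_markov (R : realType) (r c x : R) :
  0 <= r -> 0 < c -> c <= `|x| -> 1 <= abs_pow r x / c `^ r.
Proof.
move=> r0 c0 cx; rewrite ler_pdivlMr ?powR_gt0// mul1r /abs_pow.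
case: eqP cx => [->|_ cx]; first by rewrite normr0 leNgt c0.
by apply: ge0_ler_powR; rewrite ?nnegrE ?(ltW c0).
Qed.

(** [|x| = |x|^(1-r) |x|^r], and the first factor is monotone as [r <= 1]. *)
Lemma norm_le_abs_pow (R : realType) (r t x : R) :
  r <= 1 -> `|x| <= t -> `|x| <= t `^ (1 - r) * abs_pow r x.
Proof.
move=> r1 xt; rewrite /abs_pow; have [->|x0] := eqVneq x 0.
  by rewrite normr0 mulr0.
rewrite -[leLHS]powRr1// -[X in `|x| `^ X](subrK r) powRD; last first.
  by rewrite normr_eq0 x0 implybT.
rewrite ler_wpM2r ?powR_ge0//; apply: ge0_ler_powR; rewrite ?nnegrE ?subr_ge0//.
exact: le_trans xt.
Qed.

(** The factor 2 in front of [t^(1-r)] comes from the case [|b| <= t < |a|]: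
there [|S a - b| <= |a| + |b| <= |a - b| + 2 |b|], so [|b|] is paid twice.
The term in [1 / (gamma t)^r] pays for [|a - b|] in that case, and the one in
[2 / t^r] pays for it when [|b| > t]. *)
Lemma soft_threshold_entry (R : realType) (r t gamma e a b : R) (S : R -> R) :
  0 <= r -> r <= 1 -> 0 < t -> 0 < gamma -> soft_thresholding t S ->
  `|a - b| <= e ->
  `|S a - b| <= 2 * t `^ (1 - r) * abs_pow r b +
    e * (((1 - gamma) * t < `|a - b|)%R%:R
         + 1 / ((gamma * t) `^ r) * abs_pow r b
         + 2 / (t `^ r) * abs_pow r b).
Proof.
move=> r0 r1 t0 g0 softS abe; have [Sa_le Sa0 Sat] := softS a.
have e0 : 0 <= e by exact: le_trans abe.
set p := abs_pow r b; set n : R := (_ < _)%R%:R.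
have p0 : 0 <= p by exact: abs_pow_ge0.
have n0 : 0 <= n by exact: ler0n.
set u := 1 / _ * p; have uE : u = p / (gamma * t) `^ r.
  by rewrite /u div1r mulrC.
have -> : 2 / t `^ r * p = 2 * (p / t `^ r) by rewrite mulrAC mulrA.
rewrite -mulrA.
set v := p / t `^ r; set q := t `^ (1 - r) * p.
have u0 : 0 <= u by rewrite uE divr_ge0 ?powR_ge0.
have v0 : 0 <= v by rewrite divr_ge0 ?powR_ge0.
have qE : q = t * v.
  rewrite /q /v powRD; last by rewrite (gt_eqF t0) implybT.
  by rewrite powRr1 ?ltW// powRN; ring.
have q0 : 0 <= q by rewrite qE (pmulr_rge0 _ t0).
have en0 : 0 <= e * n by exact: mulr_ge0.
have eu0 : 0 <= e * u by exact: mulr_ge0.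
have ev0 : 0 <= e * v by exact: mulr_ge0.
rewrite !mulrDr (mulrCA e 2).
have [tb|bt] := ltP t `|b|.
  have v1 : 1 <= v by apply: abs_pow_markov => //; exact: ltW.
  have tq : t <= q by rewrite qE ler_peMr // ltW.
  have eev : e <= e * v by rewrite ler_peMr.
  have := ler_distD a (S a) b; lra.
have bq : `|b| <= q by exact: norm_le_abs_pow.
have [ta|at_] := ltP t `|a|; last first.
  by rewrite Sa0// sub0r normrN; lra.
have Sab : `|S a - b| <= `|a - b| + 2 * `|b|.
  have := ler_normB (S a) b; have := lerB_dist a b; lra.
suff ab_le : `|a - b| <= e * n + e * u by lra.
have [far|near] := ltP ((1 - gamma) * t) `|a - b|.
  by rewrite /n far mulr1; lra.
have gb : gamma * t <= `|b| by have := lerB_dist a b; lra.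
have u1 : 1 <= u by rewrite uE; apply: abs_pow_markov => //; exact: mulr_gt0.
have eeu : e <= e * u by rewrite ler_peMr.
lra.
Qed.

Lemma row_exceed_le_count (R : realType) (d : nat) (Gamma Sigma : 'M[R]_d)
    (c : R) (i : 'I_d) :
  \sum_j ((c < `|Gamma i j - Sigma i j|)%R%:R : R)
    <= (count_exceed Gamma Sigma c)%:R.
Proof.
rewrite -natr_sum ler_nat.
have -> : count_exceed Gamma Sigma c =
    (\sum_k \sum_j (c < `|Gamma k j - Sigma k j|)%R)%N.
  rewrite pair_bigA /count_exceed -sum1_card big_mkcond /=.
  by apply: eq_bigr => p _; rewrite inE; case: (_ < _).
by rewrite [leqRHS](bigD1 i) //= leq_addr.
Qed.

Theorem theorem6 (R : realType) (d : nat) (r t s0 M : R)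
  (Sigma : 'M[R]_d) (d_gt0 : (0 < d)%N)
  (r_ge0 : 0 <= r) (r_lt1 : r < 1) (t_gt0 : 0 < t)
  (Sigma_cov : covariance_matrix Sigma)
  (Sigma_class : sparse_class r s0 M Sigma)
  (Gamma : 'M[R]_d) (Gamma_sym : Gamma^T = Gamma)
  (S : R -> R) (S_soft : soft_thresholding t S)
  (gamma : R) (gamma_gt0 : 0 < gamma) (gamma_lt1 : gamma < 1) :
  op_norm (map_mx S Gamma - Sigma) <=
    2 * t `^ (1 - r) * s0 +
    mx_norm (Gamma - Sigma) *
      ((count_exceed Gamma Sigma ((1 - gamma) * t))%:R
       + 1 / ((gamma * t) `^ r) * s0
       + 2 / (t `^ r) * s0).
Proof.
have Asym : (map_mx S Gamma - Sigma)^T = map_mx S Gamma - Sigma.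
  by rewrite linearB /= map_trmx Gamma_sym (covariance_matrix_sym _ _ _ Sigma_cov).
set e := mx_norm _; set N := count_exceed _ _ _.
have e0 : 0 <= e.
  exact: le_trans (norm_entry_le_mx_norm _ _ _ _ (Ordinal d_gt0) (Ordinal d_gt0)).
have tr0 : 0 <= t `^ (1 - r) by exact: powR_ge0.
have u0 : 0 <= 1 / (gamma * t) `^ r by rewrite divr_ge0 ?powR_ge0.
have v0 : 0 <= 2 / t `^ r by rewrite divr_ge0 ?powR_ge0.
have row_bound i : \sum_j `|(map_mx S Gamma - Sigma) i j| <=
    2 * t `^ (1 - r) * s0 +
    e * (N%:R + 1 / (gamma * t) `^ r * s0 + 2 / t `^ r * s0).
  have [_ row_s0] := Sigma_class i.
  have entry_bound j : `|(map_mx S Gamma - Sigma) i j| <=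
      2 * t `^ (1 - r) * abs_pow r (Sigma i j) +
      e * (((1 - gamma) * t < `|Gamma i j - Sigma i j|)%R%:R
         + 1 / ((gamma * t) `^ r) * abs_pow r (Sigma i j)
         + 2 / (t `^ r) * abs_pow r (Sigma i j)).
    rewrite !mxE; apply: soft_threshold_entry => //; first exact: ltW.
    by have := norm_entry_le_mx_norm _ _ _ (Gamma - Sigma) i j; rewrite !mxE.
  apply: le_trans (ler_sum _ _) _; first by move=> j _; exact: entry_bound.
  rewrite big_split /= -!mulr_sumr !big_split /= -!mulr_sumr.
  apply: lerD; first by rewrite ler_wpM2l ?mulr_ge0.
  by rewrite ler_wpM2l// !lerD ?row_exceed_le_count// ler_wpM2l.
apply: op_norm_le_row_sum => //.
by apply: le_trans (row_bound (Ordinal d_gt0)); exact: sumr_ge0.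
Qed.
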